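(* The cycle index of the $4$-group $S_8^{(4)}$ of the symmetric group $S_8$, i.e. of the action of $S_8$ on the $70$ four-element subsets of $\{1,\dots,8\}$, in the variables $a_1,a_2,\dots$, is \begin{align*} Z(S_8^{(4)}) = \frac{1}{8!} \big(& a_{1}^{70} + 28 a_{1}^{30} a_{2}^{20} + 210 a_{1}^{14} a_{2}^{28} + 112 a_{1}^{10} a_{3}^{20} + 525 a_{1}^{6} a_{2}^{32} \\ & + 1120 a_{1}^{6} a_{2}^{2} a_{3}^{8} a_{6}^{6} + 1120 a_{1}^{4} a_{3}^{22} + 3360 a_{1}^{2} a_{4}^{2} a_{6}^{2} a_{12}^{4} + 4200 a_{1}^{2} a_{2}^{6} a_{4}^{14} \\ & + 1680 a_{1}^{2} a_{2}^{4} a_{3}^{4} a_{6}^{8} + 1260 a_{1}^{2} a_{2}^{2} a_{4}^{16} + 4032 a_{5}^{6} a_{10}^{4} + 2688 a_{5}^{2} a_{15}^{4} \\ & + 1120 a_{2}^{2} a_{3}^{10} a_{6}^{6} + 6720 a_{2}^{2} a_{3}^{2} a_{6}^{10} + 5040 a_{2} a_{4} a_{8}^{8} + 1344 a_{5}^{14} + 5760 a_{7}^{10}\big). \end{align*}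
   Context: For a permutation group $A$ on a finite set, and $\alpha\in A$, let $j_k(\alpha)$ be the number of cycles of length $k$ in the disjoint cycle decomposition of $\alpha$ (fixed points counted as cycles of length $1$). The cycle index of $A$ is the polynomial $Z(A)=\frac{1}{|A|}\sum_{\alpha\in A}\prod_{k} a_k^{j_k(\alpha)}$ in the variables $a_1,a_2,\dots$ with rational coefficients. For $1\le r\le p$, $S_p^{(r)}$ (the $r$-group of $S_p$) is the permutation group on the set of $r$-element subsets of $\{1,\dots,p\}$ formed by the permutations $\alpha'$ induced by $\alpha\in S_p$ via $\alpha'\{i_1,\dots,i_r\}=\{\alpha i_1,\dots,\alpha i_r\}$. *)

(* Defs.v *)
From mathcomp Require Import all_boot all_order all_algebra all_fingroup.
From mathcomp.multinomials Require Import monalg.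

Set Implicit Arguments.
Unset Strict Implicit.
Unset Printing Implicit Defensive.

Import GRing.Theory.
Local Open Scope group_scope.
Local Open Scope ring_scope.

(* Polynomials over the rationals in the countably many variables 'a_k:
   the algebra of the free commutative monoid on nat. The variable 'a_0
   exists but never occurs in a cycle index. *)
Notation cpoly := {malg rat[{cmonom nat}]}.

Definition cvar (k : nat) : cpoly := << ucm k >>.

Notation "''a_' k" := (cvar k) (at level 8, k at level 2, format "''a_' k").

(* [porbits s] is the set of supports of all cycles of [s], the fixed points
   being singletons. *)
Definition cycle_count (T : finType) (k : nat) (s : {perm T}) : nat :=
  #|[set C in porbits s | #|C| == k]|.

Definition cycle_index (T : finType) (A : {group {perm T}}) : cpoly :=
  (#|A|%:R)^-1 *:
    \sum_(s in A) \prod_(1 <= k < #|T|.+1) 'a_k ^+ cycle_count k s.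

Notation rsubset p r := {S : {set 'I_p} | #|S| == r}.

Section InducedPerm.
Variables p r : nat.
Implicit Types (s t : 'S_p) (S : rsubset p r).

Lemma card_imset_rsubset s S : #|s @: val S| == r.
Proof. by rewrite card_imset ?(valP S) //; exact: perm_inj. Qed.

Definition induced_fun s S : rsubset p r :=
  Sub (s @: val S) (card_imset_rsubset s S).

Lemma induced_fun_inj s : injective (induced_fun s).
Proof.
move=> S1 S2 /(congr1 val); rewrite !SubK => eqS.
by apply/val_inj; apply: imset_inj eqS; exact: perm_inj.
Qed.

Definition induced s : {perm rsubset p r} := perm (@induced_fun_inj s).

Lemma inducedM : {morph induced : s t / (s * t)%g >-> (s * t)%g}.
Proof.
move=> s t; apply/permP=> S; apply: val_inj.
rewrite permM !permE !SubK -imset_comp.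
by apply: eq_imset => i; rewrite permM.
Qed.

Canonical induced_morphism := Morphism (in2W inducedM : {in [set: 'S_p] &, _}).

End InducedPerm.

(* The r-group $S_p^{(r)}$, i.e. the image of $S_p$ in the symmetric group on
   the r-subsets. It is a group of permutations rather than an action, so each
   induced permutation counts once, however many elements of $S_p$ induce it. *)
Definition rgroup (p r : nat) : {group {perm rsubset p r}} :=
  (@induced p r @* [set: 'S_p])%G.

(* Main.v *)
Require Import Defs.
From mathcomp Require Import all_boot all_order all_algebra all_fingroup.
From mathcomp.multinomials Require Import monalg.
From mathcomp Require Import ring zify.

(* Inserting a new point into the cycles of a permutation of n points yields
   every permutation of n+1 points exactly once, which gives a recursion for
   the number of permutations of each cycle type. The k-th power of s fixes
   an r-set iff the set is a union of cycles of s^k, and an l-cycle of s splits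
   into gcd(l, k) cycles of length l / gcd(l, k) in s^k; so the number of fixed
   r-sets is a coefficient of a product of binomials 1 + X^m that only depends
   on the cycle type of s. Since this number is also the sum over the divisors
   d of k of d times the number of d-cycles of the induced permutation, the
   induced cycle counts follow by inverting this relation. For p = 8 and r = 4
   what remains is a computation over the 22 cycle types. *)

Set Implicit Arguments.
Unset Strict Implicit.
Unset Printing Implicit Defensive.

Import GRing.Theory.

(** * Cycle counts of a permutation and of its powers *)

Section CycleCounts.
Variable T : finType.
Implicit Types (s : {perm T}) (x : T) (k : nat) (C : {set T}).

Lemma porbits_partition s : partition (porbits s) [set: T].
Proof.
have -> : porbits s = equivalence_partition (fun x y => y \in porbit s x) setT.
  apply/setP=> C; apply/imsetP/imsetP => -[x _ ->]; exists x => //;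
    by apply/setP=> y; rewrite !inE.
apply: equivalence_partitionP => x y z _ _ _; rewrite porbit_id; split=> // xy.
by move: xy; rewrite porbit_sym -eq_porbit_mem => /eqP->.
Qed.

Lemma sum_porbits (V : nmodType) s (F : {set T} -> V) :
  (\sum_x F (porbit s x) = \sum_(C in porbits s) F C *+ #|C|)%R.
Proof.
have [/eqP covP tiP _] := and3P (porbits_partition s).
rewrite (eq_bigl [in cover (porbits s)]) /=; last by move=> x; rewrite covP inE.
rewrite big_trivIset //=; apply: eq_bigr => _ /imsetP[x _ ->].
rewrite -sumr_const; apply: eq_bigr => y.
by rewrite -eq_porbit_mem => /eqP->.
Qed.

Lemma cycle_count0 s : cycle_count 0 s = 0.
Proof.
apply/eqP; rewrite cards_eq0; apply/eqP/setP=> C; rewrite !inE.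
by apply/andP=> -[/imsetP[x _ ->]]; rewrite (negPf (card_porbit_neq0 s x)).
Qed.

Lemma prod_porbits (R : comPzSemiRingType) s (g : nat -> R) :
  (\prod_(C in porbits s) g #|C|
   = \prod_(k < #|T|.+1) g k ^+ cycle_count k s)%R.
Proof.
rewrite (partition_big (fun C => inord #|C| : 'I_(#|T|.+1)) predT) //=.
apply: eq_bigr => k _; rewrite /cycle_count -prodr_const.
have cardK C : (inord #|C| == k) = (#|C| == k).
  by rewrite -val_eqE /= inordK // ltnS max_card.
apply: eq_big => [C | C /andP[_]]; first by rewrite inE cardK.
by rewrite cardK => /eqP->.
Qed.

(** Exactly [k * cycle_count k s] points lie on [k]-cycles. The bound [m] is left free so that the
    range can also cover a given exponent. *)
Lemma sum_card_porbit (V : nmodType) s (F : nat -> V) m : #|T| <= m ->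
  (\sum_x F #|porbit s x| = \sum_(k < m.+1) F k *+ (k * cycle_count k s))%R.
Proof.
move=> leTm; rewrite (sum_porbits s (fun C => F #|C|)).
rewrite (partition_big (fun C => inord #|C| : 'I_m.+1) predT) //=.
apply: eq_bigr => k _; rewrite /cycle_count mulrnA -sumr_const.
have cardK C : (inord #|C| == k) = (#|C| == k).
  by rewrite -val_eqE /= inordK // ltnS (leq_trans (max_card _)).
apply: eq_big => [C | C /andP[_]]; first by rewrite inE cardK.
by rewrite cardK => /eqP->.
Qed.

(** Reduces identities between cycle counts to counting points, once a positive factor [k] is
    cancelled. *)
Lemma mul_cycle_count s k :
  k * cycle_count k s = \sum_x (#|porbit s x| == k).
Proof.
rewrite (sum_card_porbit s (fun l => l == k : nat) (leq_maxl _ k)).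
rewrite (bigD1 (Ordinal (leq_maxr #|T| k : k < (maxn _ k).+1))) //=.
rewrite eqxx natn big1 ?addr0 // => l; rewrite -val_eqE /= => /negPf->.
by rewrite mul0rn.
Qed.

Lemma permX_fix s k x : ((s ^+ k)%g x == x) = (#|porbit s x| %| k).
Proof.
have period m : (s ^+ (#|porbit s x| * m))%g x = x.
  elim: m => [|m IHm]; first by rewrite muln0 expg0 perm1.
  by rewrite mulnS expgD permM (permX s x #|_|) iter_porbit.
rewrite [in LHS](divn_eq k #|porbit s x|) mulnC expgD permM period permX.
have lt_mod : k %% #|porbit s x| < #|porbit s x|.
  by rewrite ltn_mod lt0n card_porbit_neq0.
(* The first [#|porbit s x|] iterates of [x] are distinct, so [x] returns only if the remainder is
   0. *)
have := nth_uniq x _ _ (uniq_traject_porbit s x); rewrite size_traject.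
move=> /(_ _ 0 lt_mod (leq_ltn_trans (leq0n _) lt_mod)).
by rewrite !nth_traject // (leq_ltn_trans _ lt_mod).
Qed.

Lemma sum_permX_fix s k : 0 < k ->
  \sum_x ((s ^+ k)%g x == x)
  = \sum_(d < k.+1 | d %| k) d * cycle_count d s.
Proof.
move=> k_gt0; under eq_bigr do rewrite permX_fix.
rewrite (sum_card_porbit s (fun d => d %| k : nat) (leq_maxl _ k)).
rewrite [RHS]big_mkcond /=.
pose F d := if d %| k then d * cycle_count d s else 0.
have lek : k.+1 <= (maxn #|T| k).+1 by rewrite ltnS leq_maxr.
rewrite [RHS](big_ord_widen _ F lek).
rewrite [RHS]big_mkcond; apply: eq_bigr => d _; rewrite /F.
have [|] := boolP (d %| k); last by rewrite mul0rn if_same.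
by move/(dvdn_leq k_gt0); rewrite ltnS natn => ->.
Qed.

Lemma card_porbitX s k x :
  #|porbit (s ^+ k)%g x| = #|porbit s x| %/ gcdn #|porbit s x| k.
Proof.
set l := #|porbit s x|; have l_gt0 : 0 < l by rewrite lt0n card_porbit_neq0.
have g_gt0 : 0 < gcdn l k by rewrite gcdn_gt0 l_gt0.
(* The two lengths have the same multiples, hence divide each other. *)
have dvd m : (#|porbit (s ^+ k)%g x| %| m) = (l %/ gcdn l k %| m).
  rewrite -permX_fix -expgM permX_fix -/l.
  transitivity (l %/ gcdn l k * gcdn l k %| k %/ gcdn l k * m * gcdn l k).
    by rewrite mulnAC !divnK ?dvdn_gcdl ?dvdn_gcdr.
  rewrite dvdn_pmul2r // Gauss_dvdr // /coprime.
  by rewrite -(eqn_pmul2r g_gt0) muln_gcdl mul1n !divnK ?dvdn_gcdl ?dvdn_gcdr.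
by apply/eqP; rewrite eqn_dvd dvd dvdnn -dvd dvdnn.
Qed.

Lemma cycle_countX s k d :
  cycle_count d (s ^+ k)%g =
  \sum_(l < #|T|.+1 | l %/ gcdn l k == d) gcdn l k * cycle_count l s.
Proof.
have [->|d_gt0] := posnP d.
  rewrite cycle_count0 big1 // => -[[|l] ltl] /=.
    by rewrite cycle_count0 muln0.
  have: 0 < l.+1 %/ gcdn l.+1 k.
    by rewrite divn_gt0 ?gcdn_gt0 // dvdn_leq ?dvdn_gcdl.
  by case: (_ %/ _).
apply/eqP; rewrite -(eqn_pmul2l d_gt0) mul_cycle_count; apply/eqP.
under eq_bigr do rewrite card_porbitX.
rewrite (sum_card_porbit s (fun l => l %/ gcdn l k == d : nat) (leqnn _)).
rewrite big_distrr /= [RHS]big_mkcond; apply: eq_bigr => l _.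
case: eqP => [<-|_]; last by rewrite mul0rn.
by rewrite natn mulnA divnK // dvdn_gcdl.
Qed.

Lemma prod_porbitsX (R : comPzSemiRingType) s k (g : nat -> R) :
  (\prod_(C in porbits (s ^+ k)%g) g #|C| = \prod_(l < #|T|.+1)
     g (l %/ gcdn l k)%N ^+ (gcdn l k * cycle_count l s))%R.
Proof.
rewrite prod_porbits.
under eq_bigr do rewrite cycle_countX -prodrXr big_mkcond /=.
rewrite exchange_big /=; apply: eq_bigr => l _.
have ltl : l %/ gcdn l k < #|T|.+1 by apply: leq_ltn_trans (leq_div _ _) _.
by rewrite -big_mkcond /= (big_pred1 (Ordinal ltl)).
Qed.

End CycleCounts.

(** * Inserting a point into the cycles of a permutation *)

Section Insertion.

Lemma porbit_sub (T : finType) (s : {perm T}) x (C : {set T}) :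
  x \in C -> {in C, forall y, s y \in C} -> porbit s x \subset C.
Proof.
move=> Cx stabC; apply/subsetP=> _ /porbitP[i ->].
by elim: i => [|i IHi]; rewrite ?expg0 ?perm1 // expgSr permM stabC.
Qed.

Lemma porbit_step (T : finType) (s : {perm T}) x y :
  (s y \in porbit s x) = (y \in porbit s x).
Proof. by rewrite -!eq_porbit_mem -(porbit_perm s 1 y) expg1. Qed.

(** Intertwining is asked on the orbit of [x] only: this is what holds on a cycle that an insertion
    leaves untouched. *)
Lemma porbit_imset (T T' : finType) (f : T -> T') (s : {perm T})
    (s' : {perm T'}) x :
  {in porbit s x, forall y, s' (f y) = f (s y)} ->
  porbit s' (f x) = f @: porbit s x.
Proof.
move=> fs; apply/eqP; rewrite eqEsubset; apply/andP; split.
  apply: porbit_sub => [|_ /imsetP[y xy ->]].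
    by rewrite imset_f ?porbit_id.
  by rewrite fs // imset_f // porbit_step.
rewrite sub_imset_pre.
pose C := [set y in porbit s x | f y \in porbit s' (f x)].
suff /subset_trans: porbit s x \subset C.
  by apply; apply/subsetP=> y; rewrite !inE => /andP[].
apply: porbit_sub => [|y]; rewrite !inE ?porbit_id // => /andP[xy fxy].
by rewrite porbit_step xy -fs // porbit_step.
Qed.

Variable n : nat.
Implicit Types (s : 'S_n) (i : 'I_n) (y : 'I_n.+1).

(** Products apply the left factor first: the new point [ord0] goes to [y] and the old predecessor
    of [y] goes to [ord0]. For [y = ord0] the new point is fixed. *)
Definition insert_perm s y : 'S_n.+1 := (lift0_perm s * tperm ord0 y)%g.

Lemma insert_perm0 s y : insert_perm s y ord0 = y.
Proof. by rewrite permM lift_perm_id tpermL. Qed.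

Lemma insert_perm_lift s y i : lift ord0 (s i) != y ->
  insert_perm s y (lift ord0 i) = lift ord0 (s i).
Proof. by move=> siy; rewrite permM lift_perm_lift tpermD // eq_sym. Qed.

Lemma insert_perm_lift_hit s i :
  insert_perm s (lift ord0 (s i)) (lift ord0 i) = ord0.
Proof. by rewrite permM lift_perm_lift tpermR. Qed.

Lemma insert_perm_inj : injective (fun sy => insert_perm sy.1 sy.2).
Proof.
move=> [s y] [t z] /= eq_st.
have eq_yz : y = z by rewrite -(insert_perm0 s y) eq_st insert_perm0.
move: eq_st; rewrite eq_yz => /mulIg eq_st; congr (_, _); apply/permP=> i.
apply: (@lift_inj _ ord0).
by rewrite -!(lift_perm_lift ord0) -/(lift0_perm _) eq_st.
Qed.

(** Insertion is injective, and both sides have $n!\,(n+1) = (n+1)!$ elements, so it is a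
    bijection. *)
Lemma sum_insert_perm (V : nmodType) (F : 'S_n.+1 -> V) :
  (\sum_s F s = \sum_s \sum_y F (insert_perm s y))%R.
Proof.
rewrite pair_big /= (reindex (fun sy => insert_perm sy.1 sy.2)) //=.
apply: onW_bij; apply: inj_card_bij insert_perm_inj _.
by rewrite card_prod !card_Sn card_ord mulnC factS.
Qed.

Lemma porbit_insert_id s : porbit (insert_perm s ord0) ord0 = [set ord0].
Proof.
apply/eqP; rewrite eqEsubset sub1set porbit_id andbT.
apply: porbit_sub => [|y]; rewrite inE // => /eqP->.
by rewrite insert_perm0 inE.
Qed.

Lemma porbit_insert_lift s y i : y \notin lift ord0 @: porbit s i ->
  porbit (insert_perm s y) (lift ord0 i) = lift ord0 @: porbit s i.
Proof.
move=> yi; apply: porbit_imset => j ij; rewrite insert_perm_lift //.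
by apply: contraNneq yi => <-; rewrite imset_f // porbit_step.
Qed.

Lemma porbit_insert s i :
  porbit (insert_perm s (lift ord0 i)) ord0
  = ord0 |: lift ord0 @: porbit s i.
Proof.
set t := insert_perm _ _; have t0 : t ord0 = lift ord0 i by apply: insert_perm0.
have tl j : t (lift ord0 j) = if s j == i then ord0 else lift ord0 (s j).
  case: eqP => [ji|/eqP ji]; first by rewrite /t -ji insert_perm_lift_hit.
  by rewrite /t insert_perm_lift // (inj_eq (@lift_inj _ _)).
apply/eqP; rewrite eqEsubset; apply/andP; split.
  apply: porbit_sub => [|y]; first by rewrite !inE.
  case/setU1P => [->|/imsetP[j ij ->]].
    by rewrite t0 !inE imset_f ?porbit_id ?orbT.
  rewrite tl; case: eqP => _; first by rewrite !inE.
  by rewrite inE imset_f ?orbT // porbit_step.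
rewrite subUset sub1set porbit_id /= sub_imset_pre.
apply: porbit_sub => [|j]; rewrite !inE -?t0 ?porbit_step ?porbit_id //.
(* If [s j = i], the next point is the image of [ord0]; otherwise [t] makes the same step as [s]. *)
move=> j0; have [->|ji] := eqVneq (s j) i.
  by rewrite -t0 porbit_step porbit_id.
by move: j0; rewrite -porbit_step tl (negPf ji).
Qed.

Lemma cycle_count_insert0 s k :
  cycle_count k (insert_perm s ord0) = cycle_count k s + (k == 1).
Proof.
have [->|k_gt0] := posnP k; first by rewrite !cycle_count0.
apply/eqP; rewrite -(eqn_pmul2l k_gt0) mulnDr !mul_cycle_count big_ord_recl.
rewrite porbit_insert_id cards1 addnC; apply/eqP; congr (_ + _); last first.
  by case: k k_gt0 => [|[|k]] //; rewrite muln0.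
apply: eq_bigr => i _; rewrite porbit_insert_lift ?card_imset //.
  exact: lift_inj.
by apply/imsetP=> -[].
Qed.

(** An [l]-cycle becomes an [l.+1]-cycle. The loss is written as an addition on the left, which
    avoids truncated subtraction. *)
Lemma cycle_count_insert s i k :
  cycle_count k (insert_perm s (lift ord0 i)) + (k == #|porbit s i|)
  = cycle_count k s + (k == #|porbit s i|.+1).
Proof.
set l := #|porbit s i|.
have [->|k_gt0] := posnP k.
  by rewrite !cycle_count0 /= eq_sym (negPf (card_porbit_neq0 s i)).
apply/eqP; rewrite -(eqn_pmul2l k_gt0) !mulnDr !mul_cycle_count big_ord_recl.
have card_ins : #|porbit (insert_perm s (lift ord0 i)) ord0| = l.+1.
  rewrite porbit_insert cardsU1 card_imset; last exact: lift_inj.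
  by rewrite (_ : (ord0 \notin _)) //; apply/imsetP=> -[].
(* Old points on the enlarged cycle now have orbit size [l.+1]; all others keep theirs. *)
rewrite card_ins (bigID [in porbit s i]) /=.
rewrite [X in _ == X + _](bigID [in porbit s i]) /=.
under eq_bigr => j ij.
  have -> : porbit (insert_perm s (lift ord0 i)) (lift ord0 j)
          = porbit (insert_perm s (lift ord0 i)) ord0.
    by apply/eqP; rewrite eq_porbit_mem porbit_insert inE imset_f ?orbT.
  rewrite card_ins; over.
rewrite sum_nat_const -/l.
have -> : \sum_(j in porbit s i) (#|porbit s j| == k) = l * (l == k).
  rewrite -sum_nat_const; apply: eq_bigr => j.
  by rewrite -eq_porbit_mem => /eqP->.
have -> : \sum_(j | j \notin porbit s i)
    (#|porbit (insert_perm s (lift ord0 i)) (lift ord0 j)| == k)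
  = \sum_(j | j \notin porbit s i) (#|porbit s j| == k).
  apply: eq_bigr => j ij; rewrite porbit_insert_lift ?card_imset //.
    exact: lift_inj.
  apply/imsetP=> -[z jz /lift_inj eq_iz]; case/negP: ij.
  by rewrite porbit_sym eq_iz.
have mul_eq m : k * (k == m) = m * (m == k).
  by rewrite (eq_sym m); case: eqP => [->|]; rewrite ?muln0.
by rewrite !mul_eq mulSn; apply/eqP; ring.
Qed.

End Insertion.

(** * Enumeration of cycle types with multiplicities *)

Section Enumeration.

(** The length depends on [N] alone, so permutations of different degrees share one format; entry 0
    is always 0. *)
Definition cycle_type N (T : finType) (s : {perm T}) : seq nat :=
  mkseq (fun k => cycle_count k s) N.+1.

Lemma nth_cycle_type N (T : finType) (s : {perm T}) k : k <= N ->
  nth 0 (cycle_type N s) k = cycle_count k s.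
Proof. by move=> lekN; rewrite nth_mkseq. Qed.

(* Lengthens a cycle of length [l] by one point; truncated subtraction at the
   dummy entry [0] makes [lengthen 0] the creation of a new fixed point. *)
Definition lengthen N l (j : seq nat) : seq nat :=
  mkseq (fun k => nth 0 j k + (k == l.+1) - (k == l)) N.+1.

(* The number of positions at which the new point can be inserted so as to
   perform [lengthen l]. *)
Definition insertions l (j : seq nat) : nat :=
  if l is 0 then 1 else l * nth 0 j l.

(* A pair [(w, u)] stands for [u] taken with multiplicity [w]. *)
Definition collect (U : eqType) (L : seq (nat * U)) : seq (nat * U) :=
  [seq (sumn [seq p.1 | p <- L & p.2 == u], u) | u <- undup (unzip2 L)].

(** Merging equal types after every insertion keeps the list as short as the number of types,
    instead of growing like the factorial. *)
Fixpoint cycle_types N n : seq (nat * seq nat) :=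
  if n is m.+1 then
    collect [seq (p.1 * insertions l p.2, lengthen N l p.2)
            | p <- cycle_types N m,
              l <- [seq l <- iota 0 N.+1 | 0 < insertions l p.2]]
  else [:: (1, nseq N.+1 0)].

Lemma sum_collect (V : nmodType) (U : eqType) (F : U -> V) L :
  (\sum_(p <- collect L) F p.2 *+ p.1 = \sum_(p <- L) F p.2 *+ p.1)%R.
Proof.
rewrite big_map.
under eq_bigr do rewrite /= sumnE big_map big_filter -sumrMnr.
rewrite (exchange_big_dep predT) //= big_seq [RHS]big_seq.
apply: eq_bigr => p pL; rewrite -big_filter.
have -> : [seq u <- undup (unzip2 L) | p.2 == u] = [:: p.2].
  rewrite (eq_filter (a2 := pred1 p.2)) => [|u]; last by rewrite /= eq_sym.
  rewrite filter_pred1_uniq ?undup_uniq // mem_undup; exact: map_f.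
by rewrite big_seq1.
Qed.

Lemma cycle_type_insert0 N n (s : 'S_n) :
  cycle_type N (insert_perm s ord0) = lengthen N 0 (cycle_type N s).
Proof.
apply/eq_in_map => k; rewrite mem_iota ltnS => /= lekN.
rewrite nth_cycle_type // cycle_count_insert0.
by case: k lekN => [|k] _; rewrite ?cycle_count0 ?subn0.
Qed.

Lemma cycle_type_insert N n (s : 'S_n) i :
  cycle_type N (insert_perm s (lift ord0 i))
  = lengthen N #|porbit s i| (cycle_type N s).
Proof.
apply/eq_in_map => k; rewrite mem_iota ltnS => /= lekN.
by rewrite nth_cycle_type // -cycle_count_insert addnK.
Qed.

Lemma sum_cycle_type (V : nmodType) N n (F : seq nat -> V) : n <= N ->
  (\sum_(s : 'S_n) F (cycle_type N s)
   = \sum_(p <- cycle_types N n) F p.2 *+ p.1)%R.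
Proof.
elim: n F => [|n IHn] F lenN.
  rewrite big_seq1 mulr1n (big_pred1 1%g) => [|s].
    congr F; apply: (@eq_from_nth _ 0); rewrite ?size_mkseq ?size_nseq //.
    move=> k; rewrite ltnS => lekN; rewrite nth_cycle_type // nth_nseq if_same.
    apply/eqP; rewrite cards_eq0; apply/eqP/setP=> C; rewrite !inE.
    by apply/andP=> -[/imsetP[[]]].
  by apply/esym/eqP/permP; case.
rewrite sum_insert_perm -[cycle_types N _]/(collect _) sum_collect.
rewrite big_flatten big_map.
pose G j := (\sum_(l <- iota 0 N.+1 | (0 < insertions l j)%N)
  F (lengthen N l j) *+ insertions l j)%R.
transitivity (\sum_(p <- cycle_types N n) G p.2 *+ p.1)%R; last first.
  apply: eq_bigr => p _; rewrite big_map big_filter -sumrMnl /=.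
  by apply: eq_bigr => l _; rewrite -mulrnA mulnC.
rewrite -IHn ?(ltnW lenN) //; apply: eq_bigr => s _.
(* The term [l = 0] is the new fixed point. For [l > 0] there are [l * cycle_count l s] places in
   the [l]-cycles; the filtered lengths have none and give zero terms. *)
have -> : (G (cycle_type N s) = F (lengthen N 0 (cycle_type N s)) +
   \sum_(l < N.+1) F (lengthen N l (cycle_type N s)) *+ (l * cycle_count l s))%R.
  rewrite /G -/(index_iota 0 N.+1) big_mkcond big_mkord !big_ord_recl.
  rewrite mulr1n add0r; congr (_ + _)%R; apply: eq_bigr => l _.
  have -> : insertions (lift ord0 l) (cycle_type N s)
      = lift ord0 l * cycle_count (lift ord0 l) s.
    by rewrite lift0 /insertions nth_cycle_type.
  by case: posnP => // ->; rewrite mulr0n.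
rewrite big_ord_recl cycle_type_insert0; congr (_ + _)%R.
rewrite -(sum_card_porbit s (fun l => F (lengthen N l (cycle_type N s)))).
  by apply: eq_bigr => i _; rewrite cycle_type_insert.
by rewrite card_ord ltnW.
Qed.

End Enumeration.

(** * Invariant sets and fixed points of the induced powers *)

Section InducedCycles.

(** Counts the choices of parts, distinguished by position, with total [r]: the head is either
    skipped or taken. *)
Fixpoint subset_sums (ls : seq nat) r : nat :=
  if ls is l :: ls' then
    subset_sums ls' r + (if r < l then 0 else subset_sums ls' (r - l))
  else r == 0.

Lemma coef_subset_sums ls r :
  ((\prod_(l <- ls) (1 + 'X^l) : {poly nat})`_r)%R = subset_sums ls r.
Proof.
elim: ls r => [|l ls IHls] r; first by rewrite big_nil coef1 /=; case: r.
by rewrite big_cons mulrDl mul1r coefD coefXnM !IHls.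
Qed.

Lemma prodrD1_set (R : comPzSemiRingType) (I : finType) (P : {set I})
    (F : I -> R) :
  (\prod_(i in P) (1 + F i)
   = \sum_(Q : {set I} | Q \subset P) \prod_(i in Q) F i)%R.
Proof.
(* Extension by 0 outside [P] reduces the claim to distributivity over the whole index type. *)
pose G i := if i \in P then F i else 0%R.
transitivity (\prod_i (G i + 1) : R)%R.
  rewrite big_mkcond; apply: eq_bigr => i _; rewrite /G.
  by case: (i \in P); rewrite ?add0r // addrC.
rewrite bigA_distr [RHS]big_mkcond; apply: eq_bigr => Q _.
rewrite -big_mkcond /=; case: ifPn => [/subsetP sQP|/subsetPn[i iQ iP]].
  by apply: eq_bigr => i /sQP iP; rewrite /G iP.
by rewrite (bigD1 i) //= /G (negPf iP) mul0r.
Qed.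

(** A set is invariant iff it is a union of cycles. Expanding the product runs over the sets [Q] of
    cycles, each giving ['X^#|cover Q|]; [cover] and the set of cycles inside [S] are inverse to
    each other. *)
Lemma card_invariant_sets (T : finType) (t : {perm T}) r :
  #|[set S : {set T} | (t @: S == S) && (#|S| == r)]|
  = ((\prod_(C in porbits t) (1 + 'X^#|C|) : {poly nat})`_r)%R.
Proof.
have [/eqP covP tiP _] := and3P (porbits_partition t).
rewrite prodrD1_set coef_sum.
have tiQ (Q : {set {set T}}) : Q \subset porbits t -> trivIset Q.
  by move=> sQP; apply: trivIsetS sQP tiP.
under eq_bigr => Q sQP.
  rewrite prodrXr coefXn (eqP (tiQ Q sQP)); over.
rewrite -sum1_card [LHS](reindex_onto (@cover T)
  (fun S => [set C in porbits t | C \subset S])) /=; last first.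
  move=> S; rewrite inE => /andP[/eqP tS _]; apply/setP=> x.
  apply/bigcupP/idP => [[C]|xS].
    by rewrite inE => /andP[_ /subsetP sCS] /sCS.
  exists (porbit t x); last exact: porbit_id.
  rewrite inE imset_f //; apply: porbit_sub => // y yS.
  by rewrite -[in X in _ \in X]tS imset_f.
rewrite big_mkcond [RHS]big_mkcond; apply: eq_bigr => Q _ /=.
rewrite inE; case: (boolP (Q \subset _)) => [sQP|nsQP]; last first.
  case: ifP => // /andP[_ /eqP eqQ]; case/negP: nsQP.
  by rewrite -eqQ; apply/subsetP=> C; rewrite inE => /andP[].
have -> : t @: cover Q == cover Q.
  rewrite eqEcard card_imset ?leqnn ?andbT; last exact: perm_inj.
  apply/subsetP=> _ /imsetP[x /bigcupP[C CQ xC] ->].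
  apply/bigcupP; exists C => //; move: (subsetP sQP C CQ) xC => /imsetP[y _ ->].
  by rewrite porbit_step.
have -> : [set C in porbits t | C \subset cover Q] == Q.
  apply/eqP/setP=> C; rewrite inE; apply/andP/idP => [[]|CQ]; last first.
    by rewrite (subsetP sQP) //; split=> //; apply: bigcup_sup CQ.
  case/imsetP=> x _ -> /subsetP/(_ x (porbit_id _ _))/bigcupP[D DQ xD].
  suff -> : porbit t x = D by [].
  move: (subsetP sQP D DQ) xD => /imsetP[y _ ->].
  by rewrite -eq_porbit_mem => /eqP.
by rewrite andbT eq_sym; case: eqP.
Qed.

Variables p r : nat.
Implicit Types s t : 'S_p.

Lemma inducedX s k : induced r (s ^+ k)%g = (induced r s ^+ k)%g.
Proof. exact: (morphX (@induced_morphism p r)) (in_setT s). Qed.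

(* An [l]-cycle of [s] splits into [gcdn l k] cycles of [s ^+ k]. *)
Definition power_parts (j : seq nat) k : seq nat :=
  flatten [seq nseq (gcdn l k * nth 0 j l) (l %/ gcdn l k) | l <- iota 0 p.+1].

(** The [k]-th power of the induced permutation is induced by [s ^+ k], so its fixed points are the
    invariant [r]-sets of [s ^+ k]. *)
Lemma sum_inducedX_fix s k :
  \sum_(S : rsubset p r) ((induced r s ^+ k)%g S == S)
  = subset_sums (power_parts (cycle_type p s) k) r.
Proof.
rewrite -inducedX -coef_subset_sums big_flatten big_map.
transitivity ((\prod_(C in porbits (s ^+ k)%g) (1 + 'X^#|C|) : {poly nat})`_r)%R.
  rewrite -card_invariant_sets -sum1_card.
  pose fixed (S : {set 'I_p}) : nat := (s ^+ k)%g @: S == S.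
  rewrite (eq_bigr (fun S => fixed (val S))) => [|S _]; last first.
    by rewrite permE -val_eqE.
  transitivity (\sum_(S in [pred S : {set 'I_p} | #|S| == r]) fixed S).
    exact/esym/big_sub.
  rewrite big_mkcond [RHS]big_mkcond; apply: eq_bigr => S _.
  by rewrite !inE andbC /fixed; case: (_ == r); case: (_ == _).
rewrite (prod_porbitsX s k (fun l => 1 + 'X^l : {poly nat})%R) card_ord.
rewrite -[iota _ _]/(index_iota 0 p.+1) big_mkord.
congr (nth _ (polyseq _) _); apply: eq_bigr => l _.
by rewrite nth_cycle_type -1?ltnS ?ltn_ord // big_nseq iter_mulr_1.
Qed.

End InducedCycles.

(** * Recovering the induced cycle counts *)

(* Solves [f k = \sum_(d %| k) d * c d] for [c 0 = 0, c 1, ..., c n.-1]. *)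
Fixpoint divisor_inversion (f : nat -> nat) n : seq nat :=
  if n is k.+1 then
    let c := divisor_inversion f k in
    rcons c ((f k - sumn [seq d * nth 0 c d | d <- iota 0 k & d %| k]) %/ k)
  else [::].

(** The equation for [f n] contains [n * c n] and otherwise only earlier values, so subtraction and
    division are exact. *)
Lemma divisor_inversionP f c n : c 0 = 0 ->
  (forall k, 0 < k -> f k = \sum_(d < k.+1 | d %| k) d * c d) ->
  divisor_inversion f n = mkseq c n.
Proof.
move=> c0 fE; elim: n => //= n ->; rewrite mkseqS; congr rcons.
(* At index 0 the division by zero returns 0, which agrees with [c 0]. *)
have [->|n_gt0] := posnP n; first by rewrite divn0 c0.
have -> : sumn [seq d * nth 0 (mkseq c n) d | d <- iota 0 n & d %| n]
          = \sum_(d < n | d %| n) d * c d.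
  rewrite sumnE big_map big_filter -[X in iota 0 X]subn0 -/(index_iota 0 n).
  by rewrite big_mkord; apply: eq_bigr => d _; rewrite nth_mkseq.
rewrite fE // big_mkcond big_ord_recr -big_mkcond /= dvdnn.
by rewrite addKn mulKn.
Qed.

(** The sparse exponent list of a monomial, in increasing order of the variable index. Equal
    monomials thus get equal lists, which [collect] can merge. *)
Definition induced_cycles p r (j : seq nat) : seq (nat * nat) :=
  let c := divisor_inversion (fun k => subset_sums (power_parts p j k) r)
             'C(p, r).+1 in
  [seq (k, nth 0 c k) | k <- iota 1 'C(p, r) & 0 < nth 0 c k].

Lemma card_rsubset p r : #|{: rsubset p r}| = 'C(p, r).
Proof.
rewrite card_sig -[in RHS](card_ord p) -card_draws.
by apply: eq_card => S; rewrite !inE.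
Qed.

Lemma prod_induced_cycles (R : comPzSemiRingType) p r (s : 'S_p)
    (a : nat -> R) :
  (\prod_(1 <= k < #|{: rsubset p r}|.+1) a k ^+ cycle_count k (induced r s)
   = \prod_(q <- induced_cycles p r (cycle_type p s)) a q.1 ^+ q.2)%R.
Proof.
rewrite /induced_cycles (divisor_inversionP
  (c := fun k => cycle_count k (induced r s))) ?cycle_count0 //; last first.
  by move=> k k_gt0; rewrite -sum_inducedX_fix sum_permX_fix.
rewrite card_rsubset big_map big_filter [RHS]big_mkcond /index_iota subn1.
apply: eq_big_seq => k; rewrite mem_iota add1n => /andP[_ ltk].
by rewrite nth_mkseq //=; case: posnP => // ->.
Qed.

(** * The cycle index of the [r]-group *)

(** If [s i] and [t i] differ, some [r]-set contains [i] but not the [t]-preimage of [s i]; its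
    image under [s] contains [s i], its image under [t] does not. *)
Lemma induced_inj p r : 0 < r < p -> injective (@induced p r).
Proof.
move=> /andP[r_gt0 ltrp] s t eq_st; apply/permP=> i; apply/eqP.
apply: contraT => st_i.
(* At least [p - 2] points remain, and [r.-1] of them can be chosen since [r < p]. *)
have [A sA cardA] : exists2 A : {set 'I_p},
    A \subset [set~ (t^-1)%g (s i)] :\ i & #|A| = r.-1.
  have : 0 < #|[set A : {set 'I_p} | A \subset [set~ (t^-1)%g (s i)] :\ i
                & #|A| == r.-1]|.
    rewrite cards_draws bin_gt0.
    have := cardsC1 ((t^-1)%g (s i)); rewrite (cardsD1 i) card_ord.
    by case: (i \in _) => /=; lia.
  by rewrite card_gt0 => /set0Pn[A]; rewrite inE => /andP[sA /eqP cA]; exists A.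
have iA : i \notin A by apply/negP => /(subsetP sA); rewrite !inE eqxx.
have cardiA : #|i |: A| == r by rewrite cardsU1 iA cardA add1n prednK.
have /permP/(_ (Sub (i |: A) cardiA))/(congr1 val) := eq_st.
rewrite !permE /= => eq_im.
have : s i \in t @: (i |: A) by rewrite -eq_im imset_f // setU11.
rewrite -(permKV t (s i)) mem_imset; last exact: perm_inj.
rewrite !inE => /orP[/eqP eq_i|/(subsetP sA)]; last by rewrite !inE eqxx andbF.
by case/eqP: st_i; rewrite -[in RHS]eq_i permKV.
Qed.

(** By injectivity the group has order [p]! and its elements can be indexed by ['S_p]. The outer
    [collect] merges cycle types that induce the same monomial. *)
Lemma cycle_index_rgroup p r : 0 < r < p ->
  (cycle_index (rgroup p r) = (p`!%:R)^-1 *: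
    \sum_(q <- collect [seq (wj.1, induced_cycles p r wj.2)
                       | wj <- cycle_types p p])
      (\prod_(kn <- q.2) 'a_kn.1 ^+ kn.2) *+ q.1)%R.
Proof.
move=> ltrp; have inj_ind := induced_inj ltrp.
have injm_ind : ('injm (induced_morphism p r))%g by apply/injmP; apply: in2W.
rewrite /cycle_index /= (card_injm injm_ind (subxx _)) cardsT card_Sn.
congr (_ *: _)%R.
rewrite (sum_collect (fun q => \prod_(kn <- q) 'a_kn.1 ^+ kn.2)%R).
rewrite big_map /= -(sum_cycle_type (fun j => \prod_(kn <- induced_cycles p r j)
  'a_kn.1 ^+ kn.2)%R (leqnn p)).
rewrite morphimEdom big_imset /=; last exact: in2W.
by apply: eq_big => [s|s _]; rewrite ?inE // prod_induced_cycles.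
Qed.

(** The folds unfold to left-nested sums and products with the coefficient first, the shape of the
    explicit polynomial. The start value [x] holds a leading term written without coefficient. *)
Lemma sum_monomials (R : comPzSemiRingType) (a : nat -> R) x
    (L : seq (nat * seq (nat * nat))) :
  (x + \sum_(q <- L) (\prod_(kn <- q.2) a kn.1 ^+ kn.2) *+ q.1
   = foldl (fun y q =>
       y + foldl (fun z kn => z * a kn.1 ^+ kn.2) q.1%:R q.2) x L)%R.
Proof.
elim: L x => [|[w e] L IHL] x; first by rewrite big_nil addr0.
rewrite big_cons addrA IHL /=; congr (foldl _ (_ + _) _)%R.
rewrite -mulr_natl; elim: e w%:R%R => [|kn e IHe] z.
  by rewrite big_nil mulr1.
by rewrite big_cons mulrA IHe.
Qed.

Local Open Scope ring_scope.

Theorem mainTheorem6 :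
  cycle_index (rgroup 8 4) =
  (8`!%:R : rat)^-1 *:
   ('a_1 ^+ 70
    + 28 * 'a_1 ^+ 30 * 'a_2 ^+ 20
    + 210 * 'a_1 ^+ 14 * 'a_2 ^+ 28
    + 112 * 'a_1 ^+ 10 * 'a_3 ^+ 20
    + 525 * 'a_1 ^+ 6 * 'a_2 ^+ 32
    + 1120 * 'a_1 ^+ 6 * 'a_2 ^+ 2 * 'a_3 ^+ 8 * 'a_6 ^+ 6
    + 1120 * 'a_1 ^+ 4 * 'a_3 ^+ 22
    + 3360 * 'a_1 ^+ 2 * 'a_4 ^+ 2 * 'a_6 ^+ 2 * 'a_12 ^+ 4
    + 4200 * 'a_1 ^+ 2 * 'a_2 ^+ 6 * 'a_4 ^+ 14
    + 1680 * 'a_1 ^+ 2 * 'a_2 ^+ 4 * 'a_3 ^+ 4 * 'a_6 ^+ 8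
    + 1260 * 'a_1 ^+ 2 * 'a_2 ^+ 2 * 'a_4 ^+ 16
    + 4032 * 'a_5 ^+ 6 * 'a_10 ^+ 4
    + 2688 * 'a_5 ^+ 2 * 'a_15 ^+ 4
    + 1120 * 'a_2 ^+ 2 * 'a_3 ^+ 10 * 'a_6 ^+ 6
    + 6720 * 'a_2 ^+ 2 * 'a_3 ^+ 2 * 'a_6 ^+ 10
    + 5040 * 'a_2 * 'a_4 * 'a_8 ^+ 8
    + 1344 * 'a_5 ^+ 14
    + 5760 * 'a_7 ^+ 10).
Proof.
rewrite (@cycle_index_rgroup 8 4 isT); apply: congr1.
(* The 18 terms in the order of the statement; the computation checks that they are a permutation of
   the enumerated ones. *)
rewrite (perm_big [:: (1, [:: (1, 70)]); (28, [:: (1, 30); (2, 20)]);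
  (210, [:: (1, 14); (2, 28)]); (112, [:: (1, 10); (3, 20)]);
  (525, [:: (1, 6); (2, 32)]); (1120, [:: (1, 6); (2, 2); (3, 8); (6, 6)]);
  (1120, [:: (1, 4); (3, 22)]); (3360, [:: (1, 2); (4, 2); (6, 2); (12, 4)]);
  (4200, [:: (1, 2); (2, 6); (4, 14)]);
  (1680, [:: (1, 2); (2, 4); (3, 4); (6, 8)]);
  (1260, [:: (1, 2); (2, 2); (4, 16)]); (4032, [:: (5, 6); (10, 4)]);
  (2688, [:: (5, 2); (15, 4)]); (1120, [:: (2, 2); (3, 10); (6, 6)]);
  (6720, [:: (2, 2); (3, 2); (6, 10)]); (5040, [:: (2, 1); (4, 1); (8, 8)]);
  (1344, [:: (5, 14)]); (5760, [:: (7, 10)])]%N); last by vm_compute.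
(* The first term becomes the start value; the rest, including the exponents 1, agrees by
   conversion. *)
by rewrite big_cons big_seq1 /= sum_monomials mulr1n; reflexivity.
Qed.
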